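(* $\vec\chi(Forb_{ind}(\overleftrightarrow{K_2}, \overrightarrow{C_3}, \overrightarrow{K_2}+K_1))=2$, i.e. the maximum dichromatic number of a digraph with no induced digon, no induced directed triangle and no induced copy of $\overrightarrow{K_2}+K_1$ is $2$.
   Context: Digraphs have no loops and no parallel arcs, but both $xy$ and $yx$ may be arcs. The dichromatic number $\vec\chi(D)$ is the minimum number of colors in a vertex coloring of $D$ in which no color class induces a directed cycle; for a class $\mathcal C$, $\vec\chi(\mathcal C)=\sup_{D\in\mathcal C}\vec\chi(D)$. $Forb_{ind}(\mathcal F)$ is the class of digraphs containing no member of $\mathcal F$ as an induced subdigraph. $\overleftrightarrow{K_2}$ is the digon (two vertices with arcs in both directions), $\overrightarrow{C_3}$ the directed cycle of length $3$, and $\overrightarrow{K_2}+K_1$ the disjoint union of one arc and an isolated vertex. *)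

(* Defs.v *)
From mathcomp Require Import all_boot.
From mathcomp Require Import boolp.

Set Implicit Arguments.
Unset Strict Implicit.
Unset Printing Implicit Defensive.

(* Finite digraphs; [arc x y] and [arc y x] may both hold. *)
Record digraph := Digraph {
  vertex :> finType;
  arc : rel vertex;
  arc_irr : irreflexive arc
}.
Arguments arc {d}.

(* [D] has an induced subdigraph isomorphic to [H]. *)
Definition contains_induced (D H : digraph) : Prop :=
  exists2 f : H -> D, injective f & forall x y, arc (f x) (f y) = arc x y.

(* Classes are predicates rather than elements of [classical_sets.set digraph],
   which would cause a universe inconsistency. *)
Definition dclass := digraph -> Prop.

Definition Forb_ind (F : dclass) : dclass :=
  fun D => forall H, F H -> ~ contains_induced D H.

(* A directed cycle, given by the cyclic list of its vertices; length 2 is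
   allowed (a digon). *)
Definition directed_cycle (D : digraph) (s : seq D) : bool :=
  (1 < size s) && ucycleb arc s.

Definition acyclic_set (D : digraph) (X : {set D}) : Prop :=
  forall s : seq D, directed_cycle s -> ~ {subset s <= X}.

Definition dicoloring (D : digraph) (k : nat) (c : {ffun D -> 'I_k}) : Prop :=
  forall i : 'I_k, acyclic_set [set x | c x == i].

Definition dicolorable (D : digraph) (k : nat) : Prop :=
  exists c : {ffun D -> 'I_k}, dicoloring c.

Lemma dicolorable_card (D : digraph) : dicolorable D #|D|.
Proof.
exists [ffun x => enum_rank x] => i [|x [|y s]] //.
case/andP=> _ /andP[_ /= /andP[xNys _]] sub; case/negP: xNys.
have := sub x (mem_head _ _); have : y \in [:: x, y & s].
  by rewrite !inE eqxx orbT.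
move/sub; rewrite !inE !ffunE => /eqP yi /eqP xi.
by rewrite (enum_rank_inj (etrans xi (esym yi))) eqxx.
Qed.

Lemma dicolorable_ex (D : digraph) : exists k, `[< dicolorable D k >].
Proof. by exists #|D|; apply/asboolP/dicolorable_card. Qed.

Definition dichromatic_number (D : digraph) : nat := ex_minn (dicolorable_ex D).

(* [k] is the supremum of the dichromatic numbers of the members of [C]. *)
Definition dichromatic_sup (C : dclass) (k : nat) : Prop :=
  (forall D, C D -> dichromatic_number D <= k) /\
  (forall m, (forall D, C D -> dichromatic_number D <= m) -> k <= m).

Lemma digon_irr : irreflexive (fun x y : 'I_2 => x != y).
Proof. by move=> x; rewrite eqxx. Qed.
Definition digon : digraph := Digraph digon_irr.

Lemma dicycle3_irr : irreflexive (fun x y : 'I_3 => y == ordS x).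
Proof. by case=> [[|[|[]]]]. Qed.
Definition dicycle3 : digraph := Digraph dicycle3_irr.

Lemma single_arc_irr : irreflexive (fun x y : 'I_2 => x < y).
Proof. by move=> x; rewrite ltnn. Qed.
Definition single_arc : digraph := Digraph single_arc_irr.

Definition single_vertex : digraph :=
  @Digraph unit (fun _ _ => false) (fun _ => erefl).

Definition sum_arc (D E : digraph) (u v : D + E) : bool :=
  match u, v with
  | inl x, inl y => arc x y
  | inr x, inr y => arc x y
  | _, _ => false
  end.

Lemma sum_arc_irr (D E : digraph) : irreflexive (@sum_arc D E).
Proof. by case=> x; rewrite /= arc_irr. Qed.
Definition disjoint_union (D E : digraph) : digraph := Digraph (@sum_arc_irr D E).

(* Main.v *)
From mathcomp Require Import all_boot.
From mathcomp Require Import boolp.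
Require Import Defs.

(** The members of the class are the oriented complete multipartite graphs
without directed triangles. In such a digraph a shortest directed cycle has
length 4, so it suffices to 2-color the vertices without monochromatic directed
4-cycle. Remove a whole part [C], color the rest by induction, then recolor [C]
with the first color and every vertex lying on no directed 4-cycle of the rest
with the second one. A monochromatic 4-cycle through [C] reads
[c -> b -> c' -> b' -> c] with [c, c'] in [C], and [b] lies on a directed
4-cycle [b -> x -> y -> z -> b] avoiding [C]. Having no triangle, the path
[c -> b -> x] forces [c -> x], then [b' -> c -> x] forces [b' -> x], then
[c' -> b' -> x -> y -> z] forces [c' -> z], and [c' -> z -> b -> c'] is a triangle.
The directed 4-cycle itself attains the bound. *)

Set Implicit Arguments.
Unset Strict Implicit.
Unset Printing Implicit Defensive.

(** * Forbidden subdigraphs as conditions on arcs *)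

Definition adjacent (D : digraph) (x y : D) : bool := arc x y || arc y x.

Definition four_cycle (D : digraph) (a b c d : D) : bool :=
  [&& arc a b, arc b c, arc c d & arc d a].

Definition digon_free (D : digraph) : Prop :=
  forall x y : D, arc x y -> ~~ arc y x.

Definition triangle_free (D : digraph) : Prop :=
  forall x y z : D, arc x y -> arc y z -> ~~ arc z x.

Definition multipartite (D : digraph) : Prop :=
  forall x y z : D, arc x y -> adjacent x z || adjacent y z.

Lemma adjacent_sym (D : digraph) (x y : D) : adjacent x y = adjacent y x.
Proof. exact: orbC. Qed.

Lemma adjacentxx (D : digraph) (x : D) : adjacent x x = false.
Proof. by rewrite /adjacent arc_irr. Qed.

Lemma arc_neq (D : digraph) (x y : D) : arc x y -> x != y.
Proof. by apply: contraTneq => ->; rewrite arc_irr. Qed.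

Lemma four_cycle_rot (D : digraph) (a b c d : D) :
  four_cycle a b c d -> four_cycle b c d a.
Proof. by case/and4P=> *; apply/and4P. Qed.

Lemma no_digon (D : digraph) : ~ contains_induced D digon -> digon_free D.
Proof.
move=> nD x y xy; apply/negP => yx; apply: nD.
have nxy := arc_neq xy.
exists (fun i : digon => if (i : 'I_2) == ord0 then x else y).
  by case=> [[|[|]]] // ? [[|[|]]] // ? /= e; apply: val_inj => //=;
    rewrite e eqxx in nxy.
by case=> [[|[|]]] // ? [[|[|]]] // ? /=; rewrite ?arc_irr ?xy ?yx.
Qed.

Lemma no_triangle (D : digraph) : digon_free D ->
  ~ contains_induced D dicycle3 -> triangle_free D.
Proof.
move=> dD nD x y z xy yz; apply/negP => zx; apply: nD.
have [nxy nyz nzx] := And3 (arc_neq xy) (arc_neq yz) (arc_neq zx).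
have [yx zy xz] := And3 (dD _ _ xy) (dD _ _ yz) (dD _ _ zx).
exists (fun i : dicycle3 => nth x [:: x; y; z] (i : 'I_3)).
  by case=> [[|[|[|]]]] // ? [[|[|[|]]]] // ? /= e; apply: val_inj => //=;
    rewrite e eqxx in nxy nyz nzx *.
by case=> [[|[|[|]]]] // ? [[|[|[|]]]] // ? /=;
  rewrite ?arc_irr ?xy ?yz ?zx ?(negbTE yx) ?(negbTE zy) ?(negbTE xz).
Qed.

Lemma no_arc_vertex (D : digraph) : digon_free D ->
  ~ contains_induced D (disjoint_union single_arc single_vertex) ->
  multipartite D.
Proof.
move=> dD nD x y z xy; apply/negPn/negP => /norP[] nxz nyz; apply: nD.
have nxy := arc_neq xy; have yx := negbTE (dD _ _ xy).
have zx : x != z by apply: contraNneq nyz => <-; rewrite /adjacent xy orbT.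
have zy : y != z by apply: contraNneq nxz => <-; rewrite /adjacent xy.
move: nxz nyz => /norP[/negbTE xz' /negbTE zx'] /norP[/negbTE yz' /negbTE zy'].
exists (fun u : disjoint_union single_arc single_vertex =>
   match u : 'I_2 + unit with
   | inl i => if i == ord0 then x else y | inr _ => z end).
  move=> [[[|[|]] //= ?]|[]] [[[|[|]] //= ?]|[]] //= e;
    by [congr inl; apply: val_inj | rewrite e eqxx in nxy zx zy *].
by move=> [[[|[|]] //= ?]|[]] [[[|[|]] //= ?]|[]] //=; rewrite ?arc_irr.
Qed.

(** * Directed 4-cycles and the 2-coloring *)

Section Multipartite.

Variable D : digraph.
Hypothesis D_digon_free : digon_free D.
Hypothesis D_triangle_free : triangle_free D.
Hypothesis D_multipartite : multipartite D.

(** The other direction, [arc z x], would close a directed triangle. *)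
Lemma arc_trans_adjacent (x y z : D) :
  arc x y -> arc y z -> adjacent x z -> arc x z.
Proof.
by move=> xy yz /orP[//|zx]; case/negP: (D_triangle_free xy yz).
Qed.

(** An arc between [x] and [z] would have [y] as a vertex adjacent to neither end. Nonadjacency is
    thus an equivalence relation, whose classes are the parts. *)
Lemma nonadjacent_trans (x y z : D) :
  ~~ adjacent x y -> ~~ adjacent y z -> ~~ adjacent x z.
Proof.
move=> nxy nyz; apply/negP => /orP[] /D_multipartite - /(_ y).
  by rewrite (negbTE nxy) adjacent_sym (negbTE nyz).
by rewrite (negbTE nxy) adjacent_sym (negbTE nyz).
Qed.

(** Either direction of a chord closes a triangle with one half of the cycle. *)
Lemma four_cycle_opposite (a b c d : D) :
  four_cycle a b c d -> ~~ adjacent a c.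
Proof.
case/and4P=> ab bc cd da; apply/negP => /orP[ac|ca].
  by case/negP: (D_triangle_free ac cd).
by case/negP: (D_triangle_free ab bc).
Qed.

(** Strong induction on the length: lengths 1 to 3 give a loop, a digon or a triangle, and a longer
    walk either yields a 4-cycle on its first four vertices or is shortened by a chord leaving
    [x0]. *)
Lemma closed_walk_four_cycle (X : {set D}) (s : seq D) :
  s != [::] -> cycle arc s -> {subset s <= X} ->
  exists a b c d, [/\ four_cycle a b c d, a \in X, b \in X, c \in X & d \in X].
Proof.
have [n] := ubnP (size s); elim: n s => // n IH [|x0 [|x1 [|x2 [|x3 s]]]] //.
- by rewrite /= arc_irr.
- by move=> _ _ /and3P[/D_digon_free/negP].
- by move=> _ _ /and4P[xy yz zx]; case/negP: (D_triangle_free xy yz).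
rewrite ltnS => sz _ /= /and4P[e01 e12 e23 p] sub.
have [X0 X1 X2 X3] : [/\ x0 \in X, x1 \in X, x2 \in X & x3 \in X].
  by split; apply: sub; rewrite !inE eqxx ?orbT.
case a02: (adjacent x0 x2).
  apply: (IH [:: x0, x2, x3 & s]) => //=.
    by rewrite (arc_trans_adjacent e01 e12 a02) e23.
  by move=> y ys; apply: sub; move: ys; rewrite !inE => /or3P[] ->; rewrite ?orbT.
(* [x0] is not adjacent to [x2], so the arc from [x2] to [x3] forces adjacency to [x3]: one
   direction closes a 4-cycle, the other skips [x1] and [x2]. *)
have : adjacent x3 x0.
  by move: (D_multipartite x0 e23); rewrite adjacent_sym a02.
case/orP=> [e30|e03].
  by exists x0, x1, x2, x3; split=> //; apply/and4P.
apply: (IH [:: x0, x3 & s]) => //=; first exact: leq_trans sz.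
  by rewrite e03.
by move=> y ys; apply: sub; move: ys; rewrite !inE => /or3P[] ->; rewrite ?orbT.
Qed.

Lemma four_cycle_crossing (c b c' b' x y z : D) :
  four_cycle c b c' b' -> four_cycle b x y z ->
  adjacent c x -> adjacent c' x -> adjacent c' y -> adjacent c' z -> False.
Proof.
move=> cyc1 cyc2 acx ac'x ac'y ac'z.
have nbb' := four_cycle_opposite (four_cycle_rot cyc1).
case/and4P: cyc1 => cb bc' c'b' b'c; case/and4P: cyc2 => bx xy yz zb.
have cx := arc_trans_adjacent cb bx acx.
(* [b] and [b'] are opposite, hence in the same part, and [x] is adjacent to [b]. *)
have ab'x : adjacent b' x.
  rewrite adjacent_sym.
  by move: (D_multipartite b' bx); rewrite (negbTE nbb').
have c'x := arc_trans_adjacent c'b' (arc_trans_adjacent b'c cx ab'x) ac'x.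
have c'z := arc_trans_adjacent (arc_trans_adjacent c'x xy ac'y) yz ac'z.
by case/negP: (D_triangle_free c'z zb).
Qed.

Definition on_four_cycle (X : {set D}) (v : D) : bool :=
  [exists x in X, exists y in X, exists z in X, four_cycle v x y z].

(** Relativized to [X] so that a part can be removed, by induction on [#|X|]. *)
Lemma four_cycle_coloring (X : {set D}) :
  exists f : D -> bool, forall a b c d,
    four_cycle a b c d -> a \in X -> b \in X -> c \in X -> d \in X ->
    ~ [/\ f b = f a, f c = f a & f d = f a].
Proof.
have [n] := ubnP #|X|; elim: n X => // n IH X; rewrite ltnS => leXn.
have [->|[v vX]] := set_0Vmem X.
  by exists (fun=> true) => a b c d _; rewrite inE.
(* The part of [v] within [X]; it contains [v], so [X :\: C] is smaller. *)
pose C := [set u in X | ~~ adjacent v u].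
have sCX : C \subset X by apply/subsetP => u; rewrite inE => /andP[].
have vC : v \in C by rewrite inE vX adjacentxx.
have [|g gP] := IH (X :\: C).
  apply: leq_trans leXn; apply: proper_card; rewrite properE subsetDl.
  by apply/subsetPn; exists v; rewrite // inE vC.
(* Since [C] is colored [true], a vertex outside [C] sharing its color is completed to a 4-cycle by
   vertices of [X :\: C]. *)
pose f u := if u \in C then true else on_four_cycle (X :\: C) u && g u.
have adjC u w : u \in C -> w \in X :\: C -> adjacent u w.
  rewrite !inE => /andP[_ nvu] /andP[+ wX]; rewrite wX /= negbK.
  by apply: contraLR => /(nonadjacent_trans nvu).
have memC u w : u \in C -> w \in X -> ~~ adjacent u w -> w \in C.
  by move=> uC wX; apply: contraNT => wC; apply: adjC; rewrite // inE wC.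
have thruC a b c d : four_cycle a b c d ->
    a \in X -> b \in X -> c \in X -> d \in X -> a \in C ->
    ~ [/\ f b = f a, f c = f a & f d = f a].
  move=> cyc aX bX cX dX aC [fb _ _].
  have cC := memC _ _ aC cX (four_cycle_opposite cyc).
  (* [v] is not adjacent to [a], so the arc from [a] to [b] makes it adjacent to [b]. *)
  have bC : b \notin C.
    case/and4P: (cyc) => ab _ _ _; rewrite inE bX /= negbK.
    by have := D_multipartite v ab; move: aC; rewrite inE aX adjacent_sym /=;
      move/negbTE->; rewrite adjacent_sym.
  move: fb; rewrite /f aC (negbTE bC) => /andP[+ _].
  case/exists_inP=> x xX /exists_inP[y yX /exists_inP[z zX cyc2]].
  by apply: four_cycle_crossing cyc cyc2 _ _ _ _; apply: adjC.
exists f => a b c d cyc aX bX cX dX [fb fc fd].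
have cyc1 := four_cycle_rot cyc; have cyc2 := four_cycle_rot cyc1.
have cyc3 := four_cycle_rot cyc2.
(* A monochromatic cycle meeting [C] is rotated to start in [C]. *)
case: (boolP (a \in C)) => [aC|aC]; first exact: (thruC a b c d).
case: (boolP (b \in C)) => [bC|bC].
  by apply: (thruC b c d a) => //; rewrite fb fc fd.
case: (boolP (c \in C)) => [cC|cC].
  by apply: (thruC c d a b) => //; rewrite fb fc fd.
case: (boolP (d \in C)) => [dC|dC].
  by apply: (thruC d a b c) => //; rewrite fb fc fd.
have inY u : u \in X -> u \notin C -> u \in X :\: C.
  by move=> uX uC; rewrite inE uC.
have [aY bY cY dY] := And4 (inY _ aX aC) (inY _ bX bC) (inY _ cX cC) (inY _ dX dC).
(* A 4-cycle avoiding [C] itself witnesses that its vertices keep their color under [g]. *)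
have fE p q r s : four_cycle p q r s -> p \notin C -> q \in X :\: C ->
    r \in X :\: C -> s \in X :\: C -> f p = g p.
  move=> cy pC qY rY sY; rewrite /f (negbTE pC).
  suff -> : on_four_cycle (X :\: C) p by [].
  by apply/exists_inP; exists q => //; apply/exists_inP; exists r => //;
    apply/exists_inP; exists s.
apply: (gP a b c d) => //.
by rewrite -(fE _ _ _ _ cyc) // -(fE _ _ _ _ cyc1) // -(fE _ _ _ _ cyc2) //
  -(fE _ _ _ _ cyc3).
Qed.

Lemma dicolorable2 : dicolorable D 2.
Proof.
have [f fP] := four_cycle_coloring setT.
exists [ffun u => if f u then ord0 else ord_max] => i s /andP[s1 /andP[cyc _]] sub.
have sn0 : s != [::] by case: s s1 {cyc sub}.
have [a [b [c [d [abcd aX bX cX dX]]]]] := closed_walk_four_cycle sn0 cyc sub.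
apply: (fP a b c d); rewrite ?inE //.
move: aX bX cX dX; rewrite !inE !ffunE.
by case: (f a); case: (f b); case: (f c); case: (f d) => // /eqP <-.
Qed.

End Multipartite.

(** * Bounds on the dichromatic number *)

Lemma dichromatic_number_le (D : digraph) (k : nat) :
  dicolorable D k -> dichromatic_number D <= k.
Proof.
rewrite /dichromatic_number; case: ex_minnP => m _ min_m Dk.
exact/min_m/asboolP.
Qed.

(** With no color a vertex of [s] has no image, and with one color [s] is monochromatic. *)
Lemma dichromatic_number_gt1 (D : digraph) (s : seq D) :
  directed_cycle s -> 1 < dichromatic_number D.
Proof.
rewrite /dichromatic_number; case: ex_minnP => m /asboolP[c cP] _ cyc.
case: m c cP => [|[|//]] c cP.
  by case: s cyc => // x s _; case: (c x).
by case: (cP ord0 s cyc) => x _; rewrite inE ord1.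
Qed.

(** * Sharpness: the directed 4-cycle *)

Lemma dicycle4_irr : irreflexive (fun x y : 'I_4 => y == ordS x).
Proof. by case=> [[|[|[|[]]]]]. Qed.

Definition dicycle4 : digraph := Digraph dicycle4_irr.

Lemma directed_cycle_dicycle4 :
  directed_cycle (D := dicycle4) (map inord [:: 0; 1; 2; 3]).
Proof.
rewrite /directed_cycle /ucycleb /= !inE.
by rewrite -!val_eqE /= !inordK.
Qed.

Lemma dicycle4_digon_free : ~ contains_induced dicycle4 digon.
Proof.
case=> f _ fP; have := fP ord0 ord_max; have := fP ord_max ord0.
case: (f ord0) => [[|[|[|[|]]]] //= ?];
  by case: (f ord_max) => [[|[|[|[|]]]] //= ?].
Qed.

(** Each arc adds 1 modulo 4, so three arcs never return to the start. *)
Lemma dicycle4_triangle_free : ~ contains_induced dicycle4 dicycle3.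
Proof.
case=> f _ fP.
have := fP (inord 0) (inord 1); have := fP (inord 1) (inord 2).
have := fP (inord 2) (inord 0); rewrite /= -!val_eqE /= !inordK //=.
case: (f (inord 0)) => [[|[|[|[|]]]] //= ?];
  case: (f (inord 1)) => [[|[|[|[|]]]] //= ?];
  by case: (f (inord 2)) => [[|[|[|[|]]]] //= ?].
Qed.

(** Each vertex off an arc of the 4-cycle is adjacent to an end of that arc. *)
Lemma dicycle4_arc_vertex_free :
  ~ contains_induced dicycle4 (disjoint_union single_arc single_vertex).
Proof.
case=> f f_inj fP.
pose x : disjoint_union single_arc single_vertex := inl ord0.
pose y : disjoint_union single_arc single_vertex := inl ord_max.
pose z : disjoint_union single_arc single_vertex := inr tt.
have fxz : f x <> f z by move/f_inj.
have fyz : f y <> f z by move/f_inj.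
have := fP x y; have := fP x z; have := fP z x; have := fP y z; have := fP z y.
move: fxz fyz; rewrite /= -!val_eqE /=.
case: (f x) => [[|[|[|[|]]]] //= ?]; case: (f y) => [[|[|[|[|]]]] //= ?];
  by case: (f z) => [[|[|[|[|]]]] //= ?] //= fxz fyz;
     (case: fxz + case: fyz); apply: val_inj.
Qed.

Theorem theorem9 :
  dichromatic_sup
    (Forb_ind (fun H : digraph =>
       [\/ H = digon,
            H = dicycle3
          | H = disjoint_union single_arc single_vertex]))
    2.
Proof.
split=> [D DF|m maxm].
  have dD : digon_free D by apply/no_digon/DF; constructor 1.
  apply/dichromatic_number_le/dicolorable2 => //.
    by apply: no_triangle => //; apply: DF; constructor 2.
  by apply: no_arc_vertex => //; apply: DF; constructor 3.
apply: leq_trans (dichromatic_number_gt1 directed_cycle_dicycle4) (maxm _ _).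
by move=> H [] ->; [apply: dicycle4_digon_free | apply: dicycle4_triangle_free
  | apply: dicycle4_arc_vertex_free].
Qed.
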